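(* Let $n\in\mathbb{N}=\{1,2,\ldots\}$, $\nu\ge 0$ and $0<\lambda<n^\nu$. Let $Y\sim\mathrm{CMB}(n,\lambda/n^\nu,\nu)$ and $X\sim\mathrm{CMP}(\lambda,\nu)$. Then $$d_{TV}(\mathcal{L}(Y),\mathcal{L}(X))\leq \lambda\left(\frac{\lambda}{n^\nu-\lambda}+\frac{\nu n^\nu\mathbb{E}Y}{n(n^\nu-\lambda)}\right)\left(g_\nu(\lambda)+(1+\mathbb{E}Y)\min\{1,\lambda^{-1}\}\right)+\frac{\lambda c_\nu}{n}\left(\mathbb{E}Y+\mathbb{E}Y^2\right)\min\{1,\lambda^{-1}\},$$ where $c_\nu=\max\{1,\nu\}$ and $g_\nu(\lambda)$ is the explicit function defined in the context.
   Context: $\mathbb{Z}^+=\{0,1,2,\ldots\}$. The Conway-Maxwell-Poisson distribution: $X\sim\mathrm{CMP}(\lambda,\nu)$ means $\mathbb{P}(X=j)=\frac{1}{Z(\lambda,\nu)}\frac{\lambda^j}{(j!)^\nu}$ for $j\in\mathbb{Z}^+$, where $Z(\lambda,\nu)=\sum_{i=0}^\infty \lambda^i/(i!)^\nu$; admissible parameters are $\lambda,\nu>0$, or $\nu=0$ and $0<\lambda<1$. The Conway-Maxwell-binomial distribution: for $n\in\mathbb{N}$, $0\le p\le 1$, $\nu\ge 0$, $Y\sim\mathrm{CMB}(n,p,\nu)$ means $\mathbb{P}(Y=j)=\frac{1}{C_n}\binom{n}{j}^\nu p^j(1-p)^{n-j}$ for $j\in\{0,1,\ldots,n\}$, where $C_n=\sum_{i=0}^n\binom{n}{i}^\nu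 p^i(1-p)^{n-i}$. Total variation distance between the laws of $\mathbb{Z}^+$-valued random variables: $d_{TV}(\mathcal{L}(U),\mathcal{L}(V))=\sup_{A\subseteq\mathbb{Z}^+}|\mathbb{P}(U\in A)-\mathbb{P}(V\in A)|$. The function $g_\nu(\lambda)$ is defined by: - if $\nu\ge1$ and $\lambda>1$: $g_\nu(\lambda)=\min\left\{1,\max\left\{1+\frac1\nu,\left(\frac32\right)^\nu\right\}\left(1-\lambda^{-1/(2\nu)}\right)^{1/\nu-1}\lambda^{1/(2\nu)-1}\right\}$; - if $\nu\ge1$ and $\lambda\le1$: $g_\nu(\lambda)=1$; - if $\nu<1$ and $\lambda\ge1$ (here $\nu>0$): $g_\nu(\lambda)=\left(1+\frac1\nu\right)\left(1+\lambda^{-1/(2\nu)}\right)^{1/\nu-1}\lambda^{1/(2\nu)-1}$; - if $\nu<1$ and $\lambda<1$: $g_\nu(\lambda)=\left(1-\lambda^{1-\nu}\right)^{-1}$. *)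

(* Defs.v *)
From HB Require Import structures.
From mathcomp Require Import all_boot all_order all_algebra.
From mathcomp Require Import all_classical all_reals all_analysis.

Set Implicit Arguments.
Unset Strict Implicit.
Unset Printing Implicit Defensive.

Import Order.TTheory GRing.Theory Num.Theory.
Import numFieldNormedType.Exports.

Local Open Scope classical_set_scope.
Local Open Scope ring_scope.

(** Conway-Maxwell-Poisson distribution. The limit defining [CMP_Z] exists for
    the admissible parameters: [lambda, nu > 0], or [nu = 0] and
    [0 < lambda < 1]. *)
Definition CMP_weight (R : realType) (lambda nu : R) (j : nat) : R :=
  lambda ^+ j / (j`!)%:R `^ nu.

Definition CMP_Z (R : realType) (lambda nu : R) : R :=
  limn (series (CMP_weight lambda nu)).

Definition CMP_pmf (R : realType) (lambda nu : R) (j : nat) : R :=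
  (CMP_Z lambda nu)^-1 * CMP_weight lambda nu j.

Definition is_CMP (d : measure_display) (T : measurableType d) (R : realType)
    (P : probability T R) (X : {RV P >-> nat}) (lambda nu : R) : Prop :=
  forall j : nat, distribution P X [set j] = (CMP_pmf lambda nu j)%:E.

(** Conway-Maxwell-binomial distribution. *)
Definition CMB_weight (R : realType) (n : nat) (p nu : R) (j : nat) : R :=
  ('C(n, j))%:R `^ nu * p ^+ j * (1 - p) ^+ (n - j).

Definition CMB_C (R : realType) (n : nat) (p nu : R) : R :=
  \sum_(0 <= i < n.+1) CMB_weight n p nu i.

(** The test [j <= n] cannot be left to ['C(n, j) = 0]: for [nu = 0] the power
    [0 `^ nu] is [1]. *)
Definition CMB_pmf (R : realType) (n : nat) (p nu : R) (j : nat) : R :=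
  if (j <= n)%N then (CMB_C n p nu)^-1 * CMB_weight n p nu j else 0.

Definition is_CMB (d : measure_display) (T : measurableType d) (R : realType)
    (P : probability T R) (Y : {RV P >-> nat}) (n : nat) (p nu : R) : Prop :=
  forall j : nat, distribution P Y [set j] = (CMB_pmf n p nu j)%:E.

(** Every subset of [nat] is measurable, so the supremum is over all of them;
    the set of reals below is bounded by [1]. *)
Definition dTV (R : realType) (mu1 mu2 : probability nat R) : R :=
  sup [set `|fine (mu1 A) - fine (mu2 A)| | A in [set: set nat]].

(** The moment [E(Y^k)], as a real number. [fine] is harmless when [Y] is almost
    surely bounded, as under [is_CMB]. *)
Definition moment (d : measure_display) (T : measurableType d) (R : realType)
    (P : probability T R) (Y : {RV P >-> nat}) (k : nat) : R :=
  fine ('E_P[fun w => ((Y w)%:R ^+ k : R)%R])%E.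

Definition g (R : realType) (nu lambda : R) : R :=
  if 1 <= nu then
    if 1 < lambda then
      Num.min 1 (Num.max (1 + 1 / nu) ((3 / 2) `^ nu)
                 * (1 - lambda `^ (- (1 / (2 * nu)))) `^ (1 / nu - 1)
                 * lambda `^ (1 / (2 * nu) - 1))
    else 1
  else
    if 1 <= lambda then
      (1 + 1 / nu)
      * (1 + lambda `^ (- (1 / (2 * nu)))) `^ (1 / nu - 1)
      * lambda `^ (1 / (2 * nu) - 1)
    else (1 - lambda `^ (1 - nu))^-1.

(* Main.v *)
Require Import Defs.
From HB Require Import structures.
From mathcomp Require Import all_boot all_order all_algebra.
From mathcomp Require Import all_classical all_reals all_analysis.
From mathcomp Require Import ring lra.

Set Implicit Arguments.
Unset Strict Implicit.
Unset Printing Implicit Defensive.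

Import Order.TTheory GRing.Theory Num.Theory.
Import numFieldNormedType.Exports.

Local Open Scope classical_set_scope.
Local Open Scope ring_scope.

(** Stein's method. Given a set [A], let [f] solve
    [lambda f(k+1) - k^nu f(k) = 1_A(k) - P(X in A)] with [f 0 = 0]. The death
    rates [k^nu] of the associated birth-death chain are nondecreasing, so the
    increments of [f] are at most [(1 - P(X = 0)) / lambda], hence at most
    [D = min(1, 1/lambda)], and [|f k| <= k D]. The ratio of consecutive CMB
    masses turns [E(lambda f(Y+1) - Y^nu f(Y))] into [lambda E(r(Y) f(Y+1))],
    where Bernoulli's inequality gives
    [|r(j)| <= c_nu j / n + lambda / (n^nu - lambda)]. Bounding [|f(Y+1)|] by
    [(Y+1) D] already yields the terms of the theorem carrying [D]; the term
    with [g nu lambda] is only needed to be nonnegative. *)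

(* One step of [stein_sol]: [P] is the mass at the current point, [F] the mass
   strictly below it, [S] and [a] the masses of the test set below it and in
   total, [d] the death rate. The numerator of the increment is linear in the
   masses of the test set below ([S]), at ([h * P]) and above ([r]) the point,
   and only the middle one has a positive coefficient. *)
Lemma stein_increment_ineq (R : realFieldType) (l d : R) : 0 < d ->
  forall P h p0 F S a : R, 0 < l -> 0 < P -> 0 <= h -> h <= 1 ->
  0 <= F -> S <= F -> 0 <= S -> a - (S + h * P) <= 1 - (F + P) ->
  0 <= a - (S + h * P) -> l * F <= d * (F + P - p0) ->
  d * (1 - (F + P)) <= l * (1 - F) -> 0 <= p0 ->
  `|(S + h * P - a * (F + P)) / (l * P) - (S - a * F) / (P * d)|
    <= (1 - p0) / l.
Proof.
move=> d0 P h p0 F S a l0 P0 h0 h1 F0 SF S0 r1 r0 head tail p00.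
pose u := l * (1 - F) - d * (1 - (F + P)).
pose v := d * (F + P) - l * F.
pose w := d * (1 - (F + P)) + l * F.
pose r := a - (S + h * P).
have -> : (S + h * P - a * (F + P)) / (l * P) - (S - a * F) / (P * d)
    = (h * (P * w) - S * u - r * v) / (l * (P * d)).
  by rewrite /u /v /w /r; field; rewrite !gt_eqF.
have -> : (1 - p0) / l = (P * d) * (1 - p0) / (l * (P * d)).
  by field; rewrite !gt_eqF.
rewrite normrM [`|_^-1|]gtr0_norm ?invr_gt0 ?mulr_gt0//.
rewrite ler_pM2r ?invr_gt0 ?mulr_gt0// ler_norml.
have u0 : 0 <= u by rewrite /u; lra.
have v0 : 0 <= v.
  by have := mulr_ge0 (ltW d0) p00; rewrite /v; lra.
have Pw0 : 0 <= P * w.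
  by rewrite mulr_ge0 ?(ltW P0)// /w addr_ge0//
    mulr_ge0 ?(ltW d0) ?(ltW l0)//; lra.
have Pw : P * w <= P * d * (1 - p0).
  by rewrite -mulrA ler_wpM2l ?(ltW P0)// /w; nra.
(* With [S = F] and [r = 1 - (F + P)] at their largest, the two subtracted terms add up to [P * w],
   which also bounds the positive term. *)
have Fuv : F * u + (1 - (F + P)) * v = P * w by rewrite /u /v /w; ring.
have Su : S * u <= F * u by rewrite ler_wpM2r.
have rv : r * v <= (1 - (F + P)) * v by rewrite ler_wpM2r.
have Su0 : 0 <= S * u by rewrite mulr_ge0.
have rv0 : 0 <= r * v by rewrite mulr_ge0.
have hPw0 : 0 <= h * (P * w) by rewrite mulr_ge0.
have hPw : h * (P * w) <= P * w by rewrite ler_piMl.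
by apply/andP; split; lra.
Qed.

(** * Stein equation of a birth-death chain *)

Section BirthDeathStein.
Variables (R : realType) (p h delta : nat -> R) (lam a : R).

Let F k := \sum_(i < k) p i.
Let S k := \sum_(i < k) h i * p i.

Hypothesis p_gt0 : forall k, 0 < p k.
Hypothesis lam_gt0 : 0 < lam.
Hypothesis balance : forall k, p k.+1 * delta k.+1 = lam * p k.
Hypothesis delta_homo : {homo delta : k m / (k <= m)%N >-> k <= m}.
Hypothesis F_cvg : F k @[k --> \oo] --> (1 : R).
Hypothesis h01 : forall k, 0 <= h k <= 1.
Hypothesis rest_ge0 : forall k, 0 <= a - S k.
Hypothesis rest_le : forall k, a - S k <= 1 - F k.

(** Multiplied by [p k], the left side of the Stein equation telescopes by [balance]; summing below
    [k] gives this quotient, whose denominator is also [p k * delta k]. *)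
Definition stein_sol k :=
  if k is k'.+1 then (S k - a * F k) / (lam * p k') else 0.

Let FS k : F k.+1 = F k + p k. Proof. exact: big_ord_recr. Qed.

Let SS k : S k.+1 = S k + h k * p k. Proof. exact: big_ord_recr. Qed.

Lemma stein_eq k :
  lam * stein_sol k.+1 - delta k * stein_sol k = h k - a.
Proof.
case: k => [|k] /=.
  rewrite /F /S !big_ord1 /=; have := p_gt0 0; move: (p 0) => q q0.
  by field; rewrite !gt_eqF.
rewrite (FS k.+1) (SS k.+1).
have -> : delta k.+1 = lam * p k / p k.+1.
  by rewrite -balance mulrAC mulfV ?mul1r// gt_eqF.
have := p_gt0 k.+1; have := p_gt0 k.
move: (p k) (p k.+1) (F k.+1) (S k.+1) => q q' f s q0 q'0.
by field; rewrite !gt_eqF.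
Qed.

Let F_ge0 k : 0 <= F k.
Proof. by apply: sumr_ge0 => i _; exact: ltW. Qed.

Let S_ge0 k : 0 <= S k.
Proof.
apply: sumr_ge0 => i _; have /andP[h0 _] := h01 i.
by rewrite mulr_ge0// ltW.
Qed.

Let S_le k : S k <= F k.
Proof.
apply: ler_sum => i _; have /andP[_ h1] := h01 i.
by rewrite ler_piMl// ltW.
Qed.

(** Termwise, [delta k.+1 * p j.+1 <= delta j.+1 * p j.+1 = lam * p j] for [j >= k]. Finite blocks
    are summed first, then the upper end goes to infinity. *)
Lemma birth_death_tail_le k : delta k.+1 * (1 - F k.+1) <= lam * (1 - F k).
Proof.
have F_le1 N : F N <= 1 by have := rest_ge0 N; have := rest_le N; lra.
have finite_tail m :
    delta k.+1 * (F (k + m).+1 - F k.+1) <= lam * (F (k + m)%N - F k).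
  elim: m => [|m IH]; first by rewrite addn0 !subrr !mulr0.
  rewrite addnS (FS (k + m).+1) [F (k + m).+1 in leRHS]FS.
  have := balance (k + m).
  have : delta k.+1 <= delta (k + m).+1.
    by apply: delta_homo; rewrite ltnS leq_addr.
  have := p_gt0 (k + m).+1; have := p_gt0 (k + m); nra.
rewrite mulrBr mulr1 lerBlDr.
have cvgd : delta k.+1 * F N @[N --> \oo] --> delta k.+1 * 1.
  by apply: cvgM => //; exact: cvg_cst.
rewrite mulr1 in cvgd; apply: (cvgr_to_le cvgd).
exists k.+1 => //= N /= kN.
have := finite_tail (N - k.+1)%N.
rewrite -addSn subnKC//.
have := F_le1 (k + (N - k.+1))%N.
by move=> /(ler_wpM2l (ltW lam_gt0)); lra.
Qed.

(** The same comparison for [j <= k], where the rates are at most [delta k.+1]; the index shift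
    loses [p 0]. *)
Lemma birth_death_head_le k : lam * F k.+1 <= delta k.+1 * (F k.+2 - p 0).
Proof.
rewrite [F k.+2]big_ord_recl addrC addKr.
rewrite /F !mulr_sumr; apply: ler_sum => i _ /=.
rewrite -balance mulrC ler_wpM2r ?(ltW (p_gt0 _))//.
exact: delta_homo.
Qed.

Lemma stein_sol_increment k :
  `|stein_sol k.+1 - stein_sol k| <= (1 - p 0) / lam.
Proof.
case: k => [|k] /=.
  rewrite subr0 /F /S !big_ord1 /=.
  rewrite (_ : _ / _ = (h 0 - a) / lam); last first.
    by field; rewrite !gt_eqF.
  rewrite normrM [`|lam^-1|]gtr0_norm ?invr_gt0//.
  rewrite ler_pM2r ?invr_gt0// ler_norml.
  have := rest_ge0 1; have := rest_le 1; have := rest_ge0 0.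
  have := rest_le 0; have := p_gt0 0.
  rewrite /F /S !big_ord1 !big_ord0 /=.
  by have /andP[] := h01 0; move=> ? ? ? ? ? ? ?; apply/andP; split; nra.
have d0 : 0 < delta k.+1.
  by rewrite -(pmulr_rgt0 _ (p_gt0 k.+1)) balance mulr_gt0.
rewrite -(balance k) (FS k.+1) (SS k.+1).
have /andP[h0 h1] := h01 k.+1.
apply: stein_increment_ineq => //.
- by rewrite -SS -FS.
- by rewrite -SS.
- by rewrite -FS birth_death_head_le.
(* The tail inequality at [k.+1] carries the rate [delta k.+2]; monotonicity lowers it to
   [delta k.+1]. *)
- rewrite -FS; apply: le_trans (birth_death_tail_le k.+1).
  have F_le1 : F k.+2 <= 1.
    by have := rest_ge0 k.+2; have := rest_le k.+2; lra.
  by rewrite ler_wpM2r ?subr_ge0// delta_homo.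
- exact: ltW.
Qed.

Lemma stein_sol_bound k : 1 <= delta 1 ->
  `|stein_sol k| <= k%:R * Num.min 1 lam^-1.
Proof.
move=> d1.
(* The tail inequality at [0] with [delta 1 >= 1] gives [1 - p 0 <= lam], hence the bound [1];
   positivity of [p 0] gives [1 / lam]. *)
have inc : (1 - p 0) / lam <= Num.min 1 lam^-1.
  have p0 := p_gt0 0; have p0le : 1 - p 0 <= lam.
    have := birth_death_tail_le 0; have := rest_le 1; have := rest_ge0 1.
    have F0 : F 0 = 0 by exact: big_ord0.
    by rewrite (FS 0) F0 add0r subr0 mulr1; nra.
  rewrite le_min ler_pdivrMr// mul1r p0le ler_piMl ?invr_ge0 ?(ltW lam_gt0)//.
  lra.
elim: k => [|k IH]; first by rewrite normr0 mul0r.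
rewrite -natr1 mulrDl mul1r -[stein_sol k.+1](subrK (stein_sol k)) addrC.
apply: le_trans (ler_normD _ _) _; apply: lerD => //.
exact: le_trans (stein_sol_increment k) inc.
Qed.

End BirthDeathStein.

(** * Probabilities on [nat] through point masses *)

Section NatProbability.
Variables (R : realType) (mu : probability nat R).

Let p k := fine (mu [set k]).

Let fine_ge0_mu A : 0 <= fine (mu A). Proof. exact: fine_ge0. Qed.

Lemma fine_probabilityU (A B : set nat) : A `&` B = set0 ->
  fine (mu (A `|` B)) = fine (mu A) + fine (mu B).
Proof. by move=> AB; rewrite measureU// fineD//; exact: fin_num_measure. Qed.

Lemma fine_probability_setI_ord (A : set nat) n :
  fine (mu (A `&` `I_n)) = \sum_(i < n) (val i \in A)%:R * p i.
Proof.
elim: n => [|n IH]; first by rewrite big_ord0 II0 setI0 measure0.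
rewrite big_ord_recr/= -IH IIS setIUr fine_probabilityU; last first.
  rewrite setIACA setIid (_ : `I_n `&` [set n] = set0) ?setI0//.
  by apply/seteqP; split => // k [/= kn kE]; rewrite kE ltnn in kn.
congr (_ + _); have [nA|nA] := boolP (n \in A).
  rewrite mul1r (_ : A `&` [set n] = [set n])//.
  by apply/setIidPr => _ ->; exact: set_mem.
rewrite mul0r (_ : A `&` [set n] = set0) ?measure0//.
by apply/seteqP; split => // k [/mem_set Ak /= kn];
  rewrite kn (negbTE nA) in Ak.
Qed.

Lemma fine_probability_ord n : fine (mu `I_n) = \sum_(i < n) p i.
Proof.
rewrite -[`I_n]setTI fine_probability_setI_ord.
by apply: eq_bigr => i _; rewrite in_setT mul1r.
Qed.

Lemma fine_probability_tail (A : set nat) n :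
  fine (mu A) - \sum_(i < n) (val i \in A)%:R * p i =
  fine (mu (A `\` `I_n)).
Proof.
rewrite -fine_probability_setI_ord -[in mu A](setUIDK A `I_n).
rewrite fine_probabilityU; first by rewrite addrC addKr.
by apply/seteqP; split => // k [[_ ?] []].
Qed.

Lemma fine_probability_tail_le (A : set nat) n :
  fine (mu A) - \sum_(i < n) (val i \in A)%:R * p i <= 1 - \sum_(i < n) p i.
Proof.
rewrite fine_probability_tail -fine_probability_ord -[1]/(fine 1%E).
rewrite -(@probability_setT _ _ _ mu) -(setUv `I_n).
rewrite [in leRHS]fine_probabilityU ?setICr// addrC addKr.
apply: fine_le; rewrite ?fin_num_measure//.
by apply: le_measure; rewrite ?inE// => k [].
Qed.

Lemma cvg_fine_probability_ord : (\sum_(i < n) p i) @[n --> \oo] --> (1 : R).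
Proof.
under eq_fun do rewrite -fine_probability_ord.
apply: fine_cvg.
have -> : 1%:E = mu (\bigcup_n `I_n).
  rewrite (_ : \bigcup_n `I_n = setT) ?probability_setT//.
  by apply/seteqP; split => // k _; exists k.+1 => /=.
apply: nondecreasing_cvg_mu => // m n mn.
by apply/subsetPset => k /= /leq_trans; apply.
Qed.

Section FiniteSupport.
Variable n : nat.
Hypothesis p1 : \sum_(i < n) p i = 1.

(** The mass of [A] beyond [n] lies between [0] and the total mass beyond [n], which vanishes by
    [p1]. *)
Lemma fine_probability_finite (A : set nat) :
  fine (mu A) = \sum_(i < n) (val i \in A)%:R * p i.
Proof.
apply/eqP; rewrite -subr_eq0 eq_le; apply/andP; split.
  by rewrite (le_trans (fine_probability_tail_le A n))// p1 subrr.
by rewrite fine_probability_tail.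
Qed.

Lemma integral_probability_finite (f : nat -> R) : (forall i, 0 <= f i) ->
  (\int[mu]_i (f i)%:E = (\sum_(i < n) f i * p i)%:E)%E.
Proof.
move=> f0.
(* [mu] equals this combination of Dirac masses, whose integrals are evaluations. *)
pose m := msum (fun i => mscale (NngNum (fine_ge0_mu [set i])) \d_i) n.
rewrite (eq_measure_integral m); last first.
  move=> A _ _; rewrite -[LHS]fineK ?fin_num_measure//.
  rewrite fine_probability_finite /m /msum/= -sumEFin.
  apply: eq_bigr => i _.
  by rewrite mulrC EFinM; congr (_ * _)%E; exact/esym/diracE.
rewrite ge0_integral_measure_sum//; last by move=> i _; rewrite lee_fin.
rewrite -sumEFin; apply: eq_bigr => i _.
rewrite ge0_integral_mscale//; last by move=> k _; rewrite lee_fin.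
by rewrite integral_dirac// diracT mul1e/= EFinM muleC.
Qed.

End FiniteSupport.
End NatProbability.

Lemma stein_solution_probability (R : realType) (mu : probability nat R)
    (delta : nat -> R) (lam : R) (A : set nat) :
  (forall k, 0 < fine (mu [set k])) -> 0 < lam ->
  (forall k, fine (mu [set k.+1]) * delta k.+1 = lam * fine (mu [set k])) ->
  {homo delta : k m / (k <= m)%N >-> k <= m} -> 1 <= delta 1 ->
  exists f : nat -> R, [/\ f 0 = 0,
    forall k, lam * f k.+1 - delta k * f k = (k \in A)%:R - fine (mu A) &
    forall k, `|f k| <= k%:R * Num.min 1 lam^-1].
Proof.
move=> p0 lam0 balance delta_homo d1.
exists (stein_sol (fun k => fine (mu [set k])) (fun k => (k \in A)%:R)
  lam (fine (mu A))); split => // k.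
  exact: stein_eq.
apply: stein_sol_bound => //.
- exact: cvg_fine_probability_ord.
- by move=> j; case: (_ \in _); rewrite lexx ler01.
- by move=> j; rewrite fine_probability_tail fine_ge0.
- by move=> j; exact: fine_probability_tail_le.
Qed.

(** * Stein solutions for the CMP law *)

Section CMP.
Variables (R : realType) (mu : probability nat R) (lam nu : R).
Hypothesis lam_gt0 : 0 < lam.
Hypothesis mu_CMP : forall j, mu [set j] = (CMP_pmf lam nu j)%:E.

Lemma CMP_weight_gt0 j : 0 < CMP_weight lam nu j.
Proof. by rewrite divr_gt0 ?exprn_gt0 ?powR_gt0 ?ltr0n ?fact_gt0. Qed.

(** Detailed balance for birth rate [lam] and death rates [k^nu], before normalisation. *)
Lemma CMP_weightS j :
  CMP_weight lam nu j.+1 * j.+1%:R `^ nu = lam * CMP_weight lam nu j.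
Proof.
rewrite /CMP_weight factS natrM powRM// exprS.
have := @powR_gt0 R j.+1%:R nu (ltr0Sn _ _).
have := @powR_gt0 R j`!%:R nu; rewrite ltr0n fact_gt0 => /(_ isT).
move: (_ `^ _) (_ `^ _) => x y x0 y0.
by field; rewrite !gt_eqF.
Qed.

(* [Z^-1 = 0], the junk value for a divergent series, would make all the
   masses vanish. *)
Lemma CMP_pmf_gt0 j : 0 < CMP_pmf lam nu j.
Proof.
rewrite /CMP_pmf mulr_gt0 ?CMP_weight_gt0// lt_neqAle eq_sym.
apply/andP; split; last first.
  rewrite -(pmulr_lge0 _ (CMP_weight_gt0 0)) -lee_fin -/(CMP_pmf lam nu 0).
  by rewrite -mu_CMP.
apply/eqP => Z0; have := @cvg_fine_probability_ord R mu.
have -> : (fun n => \sum_(i < n) fine (mu [set val i])) = cst 0.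
  apply/funext => n; apply: big1 => i _.
  by rewrite mu_CMP /CMP_pmf Z0 mul0r.
move=> /(cvg_unique (@norm_hausdorff _ _) (@cvg_cst _ _ _ _ _))/eqP.
by rewrite eq_sym oner_eq0.
Qed.

Lemma CMP_stein (A : set nat) : 0 <= nu ->
  exists f : nat -> R, [/\ f 0 = 0,
    forall k, lam * f k.+1 - k%:R `^ nu * f k = (k \in A)%:R - fine (mu A) &
    forall k, `|f k| <= k%:R * Num.min 1 lam^-1].
Proof.
(* For [nu = 0] the rate at [0] is [0^0 = 1]; it multiplies [f 0 = 0] and keeps the rates
   nondecreasing. *)
move=> nu0; apply: (stein_solution_probability (delta := fun k => k%:R `^ nu)).
- by move=> k; rewrite mu_CMP CMP_pmf_gt0.
- exact: lam_gt0.
- by move=> k; rewrite !mu_CMP/= /CMP_pmf -mulrA CMP_weightS mulrCA.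
- by move=> k m km; rewrite ge0_ler_powR ?nnegrE ?ler_nat.
- by rewrite powR1.
Qed.

End CMP.

(** As [x <= 1], raising the exponent to [c >= 1] only lowers the power. Then [x^c = x * x^(c - 1)
    >= x + (c - 1) * (x * ln x)], and [x * ln x >= x - 1]. *)
Lemma powR_bernoulli (R : realType) (nu x : R) : 0 < x -> x <= 1 ->
  1 - x `^ nu <= Num.max 1 nu * (1 - x).
Proof.
move=> x0 x1; set c := Num.max 1 nu; have c1 : 1 <= c by rewrite le_max lexx.
have : x `^ c <= x `^ nu.
  by apply: ger_powR; rewrite ?x0// le_max lexx orbT.
have xc : x `^ c = x * x `^ (c - 1).
  by rewrite mulr_powRB1 ?(ltW x0)// (lt_le_trans ltr01).
(* Both logarithmic bounds are the tangent inequality [1 + t <= exp t]. *)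
have e1 : 1 + (c - 1) * ln x <= x `^ (c - 1).
  by rewrite /powR gt_eqF// expR_ge1Dx.
have e2 : 1 - ln x <= x^-1.
  by rewrite -[x in x^-1]lnK// -expRN expR_ge1Dx.
have e3 : x - 1 <= x * ln x.
  have := ler_wpM2l (ltW x0) e2; rewrite mulfV ?gt_eqF//; lra.
have := ler_wpM2l (ltW x0) e1; nra.
Qed.

(** * Mass ratios of the CMB law *)

Section CMB.
Variables (R : realType) (n : nat) (nu lam : R).
Hypothesis n_gt0 : (0 < n)%N.
Hypothesis nu_ge0 : 0 <= nu.
Hypothesis lam_gt0 : 0 < lam.
Hypothesis lam_lt : lam < n%:R `^ nu.

Let N := n%:R `^ nu.
Let w := CMB_weight n (lam / N) nu.
Let q := CMB_pmf n (lam / N) nu.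
Let c := Num.max 1 nu.

Let N_gt0 : 0 < N. Proof. by rewrite powR_gt0// ltr0n. Qed.

Let p_lt1 : 0 < 1 - lam / N.
Proof. by rewrite subr_gt0 ltr_pdivrMr// mul1r. Qed.

Let w_gt0 j : (j <= n)%N -> 0 < w j.
Proof.
move=> jn; rewrite /w /CMB_weight !mulr_gt0 ?exprn_gt0 ?divr_gt0//.
by rewrite powR_gt0// ltr0n bin_gt0.
Qed.

Let C_gt0 : 0 < CMB_C n (lam / N) nu.
Proof.
rewrite /CMB_C big_nat_recr//= ltr_wpDl ?w_gt0//.
rewrite big_nat; apply: sumr_ge0 => i /andP[_ /ltnW i_n].
exact/ltW/w_gt0.
Qed.

Lemma CMB_pmf_ge0 j : 0 <= q j.
Proof.
rewrite /q /CMB_pmf; case: ifP => // jn.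
by rewrite mulr_ge0 ?invr_ge0 ?ltW// w_gt0.
Qed.

Lemma CMB_pmf_sum : \sum_(i < n.+1) q i = 1.
Proof.
rewrite /q /CMB_pmf; under eq_bigr => i _ do rewrite -ltnS ltn_ord.
rewrite -mulr_sumr -(big_mkord xpredT (CMB_weight _ _ _)) mulVf//.
by rewrite gt_eqF.
Qed.

(** Combines [(j + 1) C(n, j + 1) = (n - j) C(n, j)], raised to the power [nu], with the odds
    [lam / (N - lam)] of [lam / N]. *)
Lemma CMB_pmfS j : (j < n)%N ->
  q j.+1 * j.+1%:R `^ nu = lam * ((n - j)%:R `^ nu / (N - lam)) * q j.
Proof.
move=> jn; rewrite /q /CMB_pmf jn (ltnW jn) /CMB_weight -/N.
have bin : 'C(n, j.+1)%:R `^ nu * j.+1%:R `^ nu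
    = (n - j)%:R `^ nu * 'C(n, j)%:R `^ nu.
  by rewrite -!powRM// -!natrM mulnC mul_bin_left.
have -> : (1 - lam / N) ^+ (n - j)
    = (1 - lam / N) ^+ (n - j.+1) * (1 - lam / N).
  by rewrite -(subnSK jn) exprSr.
rewrite exprS.
transitivity ((CMB_C n (lam / N) nu)^-1 *
    ('C(n, j.+1)%:R `^ nu * j.+1%:R `^ nu) *
    (lam / N) * (lam / N) ^+ j * (1 - lam / N) ^+ (n - j.+1)).
  by ring.
rewrite bin.
have := C_gt0; move: (CMB_C _ _ _) => C C0.
have Nl : 0 < N - lam by rewrite subr_gt0.
move: (_ ^+ j) (_ ^+ (n - j.+1)) (_ `^ nu) (_ `^ nu) => x y z t.
by field; rewrite !gt_eqF.
Qed.

(** [1 - r j] is the factor multiplying [lam * q j] in [CMB_pmfS]. At [j = n] it has to be [0],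
    whereas [0^nu] is [1] for [nu = 0]. *)
Let r j : R := 1 - (if (j < n)%N then (n - j)%:R `^ nu / (N - lam) else 0).

Lemma CMB_coef_bound j : (j <= n)%N ->
  `|r j| <= c * j%:R / n%:R + lam / (N - lam).
Proof.
move=> jn; rewrite /r; have Nl : 0 < N - lam by rewrite subr_gt0.
have c1 : 1 <= c by rewrite le_max lexx.
have n0 : 0 < n%:R :> R by rewrite ltr0n.
have l0 : 0 <= lam / (N - lam) by rewrite ltW// divr_gt0.
case: ltnP => [jn'|nj]; last first.
  have -> : j = n by apply/eqP; rewrite eqn_leq jn.
  by rewrite subr0 normr1 mulfK ?gt_eqF//; lra.
pose x : R := (n - j)%:R / n%:R.
have x0 : 0 < x by rewrite divr_gt0// ltr0n subn_gt0.
have xE : 1 - x = j%:R / n%:R by rewrite /x natrB//; field; rewrite gt_eqF.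
have x1 : x <= 1 by rewrite -subr_ge0 xE divr_ge0.
have -> : (n - j)%:R `^ nu = x `^ nu * N.
  by rewrite -powRM ?(ltW x0)// /x divfK// gt_eqF.
have := powR_bernoulli nu x0 x1; rewrite xE mulrA.
have t1 : x `^ nu <= 1.
  rewrite [leRHS](_ : 1 = 1 `^ nu); last by rewrite powR1.
  by rewrite ge0_ler_powR ?nnegrE ?(ltW x0).
move: (x `^ nu) t1 (powR_ge0 x nu) => t t1 t0 b.
(* Since [N / (N - lam) = 1 + lam / (N - lam)], Bernoulli bounds the first part and [t <= 1] the
   second. *)
rewrite (_ : 1 - _ = (1 - t) - t * (lam / (N - lam))); last first.
  by field; rewrite gt_eqF.
rewrite (le_trans (ler_normB _ _))// ger0_norm ?subr_ge0// lerD//.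
by rewrite (ger0_norm (mulr_ge0 t0 l0)) ler_piMl.
Qed.

(** The [j^nu] sum starts at [j = 1] because [f 0 = 0]; shifting it by one lets [CMB_pmfS] merge the
    two sums. The unpaired term [j = n] has [r n = 1]. *)
Lemma CMB_stein_sum (f : nat -> R) : f 0 = 0 ->
  \sum_(j < n.+1) q j * (lam * f j.+1 - j%:R `^ nu * f j)
  = \sum_(j < n.+1) lam * q j * r j * f j.+1.
Proof.
move=> f0; under eq_bigr => j _ do rewrite mulrBr.
rewrite sumrB [X in _ - X]big_ord_recl/= f0 !mulr0 add0r.
rewrite big_ord_recr [RHS]big_ord_recr/= /r ltnn subr0 addrAC.
congr (_ + _); last by rewrite mulr1 mulrA [q n * _]mulrC.
rewrite -sumrB; apply: eq_bigr => j _; rewrite ltn_ord.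
rewrite [q _.+1 * _]mulrA CMB_pmfS//; ring.
Qed.

Let m k := \sum_(j < n.+1) j%:R ^+ k * q j.

Lemma CMB_stein_bound (f : nat -> R) (D : R) :
  f 0 = 0 -> (forall k, `|f k| <= k%:R * D) ->
  `|\sum_(j < n.+1) q j * (lam * f j.+1 - j%:R `^ nu * f j)|
  <= lam * (lam / (N - lam)) * ((1 + m 1%N) * D)
     + lam * c / n%:R * (m 1%N + m 2%N) * D.
Proof.
move=> f0 fD; rewrite CMB_stein_sum//.
rewrite (le_trans (ler_norm_sum _ _ _))//.
(* The [1] in [1 + m 1] becomes the total mass, so that both sides compare term by term. *)
rewrite -{1}CMB_pmf_sum /m -!big_split/= !(mulr_suml, mulr_sumr) -big_split/=.
apply: ler_sum => j _; have q0 := CMB_pmf_ge0 j.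
rewrite -mulrA normrM ger0_norm ?mulr_ge0 ?(ltW lam_gt0)//.
have rf : `|r j * f j.+1| <=
    (c * j%:R / n%:R + lam / (N - lam)) * ((j%:R + 1) * D).
  by rewrite normrM ler_pM// ?natr1// CMB_coef_bound// -ltnS.
apply: le_trans (ler_wpM2l (mulr_ge0 (ltW lam_gt0) q0) rf) _.
by rewrite le_eqVlt; apply/orP; left; apply/eqP; ring.
Qed.

End CMB.

(** * Moments and the final comparison *)

Lemma moment_finite (R : realType) (d : measure_display)
    (T : measurableType d) (P : probability T R) (Y : {RV P >-> nat})
    (n k : nat) : \sum_(i < n) fine (distribution P Y [set val i]) = 1 ->
  moment Y k = \sum_(i < n) i%:R ^+ k * fine (distribution P Y [set val i]).
Proof.
move=> Y1; rewrite /moment unlock.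
rewrite -(@ge0_integral_distribution _ _ _ _ _ P Y
  (fun i : nat => (i%:R ^+ k)%:E))//.
by rewrite (integral_probability_finite Y1).
Qed.

Lemma g_ge0 (R : realType) (nu lambda : R) :
  0 <= nu -> 0 < lambda -> 0 <= g nu lambda.
Proof.
move=> nu0 l0; rewrite /g; case: ifP => nu1; case: ifP => l1 //.
- rewrite le_min ler01 !mulr_ge0 ?powR_ge0//.
  by rewrite le_max powR_ge0 orbT.
- by rewrite !mulr_ge0 ?powR_ge0// addr_ge0// divr_ge0.
rewrite invr_ge0 subr_ge0 [leRHS](_ : 1 = 1 `^ (1 - nu)); last by rewrite powR1.
have lt1 : lambda < 1 by rewrite ltNge l1.
rewrite ge0_ler_powR ?nnegrE ?(ltW l0) ?(ltW lt1)// subr_ge0.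
by rewrite ltW// ltNge nu1.
Qed.

Theorem theorem3p1 (R : realType) (n : nat) (nu lambda : R)
    (dY dX : measure_display)
    (TY : measurableType dY) (PY : probability TY R) (Y : {RV PY >-> nat})
    (TX : measurableType dX) (PX : probability TX R) (X : {RV PX >-> nat})
    (hn : (0 < n)%N) (hnu : 0 <= nu)
    (hlambda0 : 0 < lambda) (hlambda : lambda < n%:R `^ nu)
    (hY : is_CMB Y n (lambda / n%:R `^ nu) nu)
    (hX : is_CMP X lambda nu) :
  let EY := moment Y 1 in
  let EY2 := moment Y 2 in
  let c := Num.max 1 nu in
  dTV (distribution PY Y) (distribution PX X) <=
    lambda * (lambda / (n%:R `^ nu - lambda)
              + nu * n%:R `^ nu * EY / (n%:R * (n%:R `^ nu - lambda)))
      * (g nu lambda + (1 + EY) * Num.min 1 (lambda^-1))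
    + lambda * c / n%:R * (EY + EY2) * Num.min 1 (lambda^-1).
Proof.
cbv zeta; set EY := moment Y 1; set EY2 := moment Y 2; set c := Num.max 1 nu.
set N := n%:R `^ nu; set D := Num.min 1 lambda^-1.
pose q := CMB_pmf n (lambda / N) nu.
have fineY j : fine (distribution PY Y [set j]) = q j by rewrite hY.
have q1 : \sum_(i < n.+1) q i = 1 by exact: CMB_pmf_sum.
have Y1 : \sum_(i < n.+1) fine (distribution PY Y [set val i]) = 1.
  by under eq_bigr => i _ do rewrite fineY.
have momentE k : moment Y k = \sum_(i < n.+1) i%:R ^+ k * q i.
  by rewrite (moment_finite _ Y1); under eq_bigr => i _ do rewrite fineY.
have EY0 : 0 <= EY.
  rewrite /EY momentE sumr_ge0// => i _.
  by rewrite mulr_ge0 ?exprn_ge0 ?CMB_pmf_ge0.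
apply: ge_sup; first by exists `|fine (distribution PY Y set0) -
  fine (distribution PX X set0)|, set0.
move=> _ [A _ <-].
have [f [f0 fE fD]] := CMP_stein hlambda0 hX A hnu.
(* Averaging the Stein equation over the law of [Y] turns its right side into the difference of the
   two probabilities. *)
have -> : fine (distribution PY Y A) - fine (distribution PX X A) =
    \sum_(j < n.+1) q j * (lambda * f j.+1 - j%:R `^ nu * f j).
  under eq_bigr => j _ do rewrite fE mulrBr.
  rewrite sumrB -mulr_suml q1 mul1r (fine_probability_finite Y1).
  by congr (_ - _); apply: eq_bigr => j _; rewrite fineY mulrC.
apply: le_trans (CMB_stein_bound hn hnu hlambda0 hlambda f0 fD) _.
rewrite -!momentE -/EY -/EY2 -/c -/N -/D lerD2r.
have Nl : 0 < N - lambda by rewrite subr_gt0.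
have D0 : 0 <= D by rewrite le_min ler01 invr_ge0 ltW.
have g0 := g_ge0 hnu hlambda0.
(* Both factors only grow: the first by the nonnegative [nu] summand, the second by
   [g nu lambda]. *)
apply: ler_pM.
- by rewrite mulr_ge0 ?divr_ge0 ?ltW.
- by rewrite mulr_ge0// addr_ge0.
- rewrite ler_wpM2l ?(ltW hlambda0)// lerDl.
  by rewrite divr_ge0 ?mulr_ge0 ?powR_ge0 ?(ltW Nl).
- by rewrite lerDr.
Qed.
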